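(* Let $\underline{s}$ be an ultimately periodic right boundary. Then the ordinary generating function $$\sum_{n=0}^{\infty} \mathrm{LP}_n(\underline{s})\, z^n$$ is algebraic (that is, algebraic over the field $\mathbb{C}(z)$ of rational functions).
   Context: A (right) boundary is a non-decreasing infinite sequence $\underline{s}=(s_0,s_1,s_2,\ldots)$ of positive integers. A lattice path is a path in the plane starting at the origin with unit north steps $N$ (adding $(0,1)$) and unit east steps $E$ (adding $(1,0)$). If $x$ is a positive integer, a lattice path from $(0,0)$ to $(x-1,n)$ is coded by the non-decreasing sequence $(x_0,\ldots,x_{n-1})$, $0\le x_i\le x-1$, where $x_i$ is the $x$-coordinate of the $(i+1)$-st north step. Such a path is an $\underline{s}$-lattice path if $x_i<s_i$ for $0\le i\le n-1$. $\mathrm{LP}_n(\underline{s})$ is the number of $\underline{s}$-lattice paths from $(0,0)$ to $(s_n-1,n)$; equivalently, the number of integer sequences $0\le x_0\le x_1\le\cdots\le x_{n-1}$ with $x_i<s_i$ for all $0\le i\le n-1$ (so $\mathrm{LP}_0(\underline{s})=1$). A boundary $\underline{s}$ is periodic of height $k$ and width $l$ ($k\ge 1$) if there is a finite non-decreasing sequence $s_0,s_1,\ldots,s_{k-1}$ of positive integers with $s_{k-1}=l$ such that for all $m\ge 0$, $s_m=s_r+ql$, where $q=\lfloor m/k\rfloor$ and $r=m-qk$. A boundary is ultimately periodic if it is the concatenation $\underline{s}',\, p+\underline{s}''$, where $\underline{s}'$ is a finite initial sequence whose last term is $p$, $\underline{s}''$ is a periodic boundary, and $p+\underline{s}''$ denotes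 the sequence obtained by adding $p$ to each term of $\underline{s}''$. *)

(* Defs.v *)
From HB Require Import structures.
From mathcomp Require Import all_boot all_order all_algebra.
From mathcomp Require Import boolp reals.

Set Implicit Arguments.
Unset Strict Implicit.
Unset Printing Implicit Defensive.

Import GRing.Theory.
Local Open Scope nat_scope.

Definition right_boundary (s : nat -> nat) : Prop :=
  (forall i, 0 < s i) /\ {homo s : i j / i <= j}.

Definition periodic_boundary (k l : nat) (s : nat -> nat) : Prop :=
  0 < k /\
  exists t : k.-tuple nat,
    [/\ all (fun x => 0 < x) t, sorted leq t, last 0 t = l
      & forall m, s m = nth 0 t (m %% k) + (m %/ k) * l].

(* The prefix s' may be empty, with p = last 0 [::] = 0; this adds no new
   boundaries, because a periodic boundary s of height k and width l is also
   the concatenation of its first k terms with l + s. *)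
Definition ultimately_periodic (s : nat -> nat) : Prop :=
  exists (s' : seq nat) (s'' : nat -> nat) (k l : nat),
    periodic_boundary k l s'' /\
    forall m, s m = if m < size s' then nth 0 s' m
                    else last 0 s' + s'' (m - size s').

(* Lattice paths from (0,0) to (x-1,n), coded by the x-coordinates
   of their n north steps. *)
Definition lattice_paths (x n : nat) : {set n.-tuple 'I_x} :=
  [set p : n.-tuple 'I_x | sorted leq [seq val a | a <- p]].

Definition LP (s : nat -> nat) (n : nat) : nat :=
  #|[set p in lattice_paths (s n) n | [forall i : 'I_n, tnth p i < s i]]|.

Local Open Scope ring_scope.

(* K[[z]]; [Fps f] is the series with n-th coefficient [f n]. *)
Record fps (K : Type) := Fps { coefs : nat -> K }.

Section FpsRing.
Variable K : fieldType.
Implicit Types f g h : fps K.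

HB.instance Definition _ := [isNew for @coefs K].
HB.instance Definition _ := [Choice of fps K by <:].

Lemma fpsP f g : coefs f =1 coefs g <-> f = g.
Proof.
split=> [e|-> //]; case: f g e => [f] [g] /= e.
by congr Fps; apply: funext.
Qed.

Definition fps_zero : fps K := Fps (fun=> 0).
Definition fps_one : fps K := Fps (fun n => (n == 0%N)%:R).
Definition fps_opp f := Fps (fun n => - coefs f n).
Definition fps_add f g := Fps (fun n => coefs f n + coefs g n).
Definition fps_mul f g :=
  Fps (fun n => \sum_(i < n.+1) coefs f i * coefs g (n - i)).

Lemma fps_addA : associative fps_add.
Proof. by move=> f g h; apply/fpsP => n /=; rewrite addrA. Qed.
Lemma fps_addC : commutative fps_add.
Proof. by move=> f g; apply/fpsP => n /=; rewrite addrC. Qed.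
Lemma fps_add0 : left_id fps_zero fps_add.
Proof. by move=> f; apply/fpsP => n /=; rewrite add0r. Qed.
Lemma fps_addN : left_inverse fps_zero fps_opp fps_add.
Proof. by move=> f; apply/fpsP => n /=; rewrite addNr. Qed.

HB.instance Definition _ :=
  GRing.isZmodule.Build (fps K) fps_addA fps_addC fps_add0 fps_addN.

Definition fps_trunc m f : {poly K} := \poly_(i < m.+1) coefs f i.

Lemma coef_trunc m f i : (i <= m)%N -> (fps_trunc m f)`_i = coefs f i.
Proof. by move=> im; rewrite coef_poly ltnS im. Qed.

Lemma coefs_mulE m f g n : (n <= m)%N ->
  coefs (fps_mul f g) n = (fps_trunc m f * fps_trunc m g)`_n.
Proof.
move=> nm; rewrite coefM /=; apply: eq_bigr => i _.
by rewrite !coef_trunc ?(leq_trans (leq_subr _ _)) // (leq_trans _ nm) // -ltnS.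
Qed.

Lemma fps_mulC : commutative fps_mul.
Proof.
by move=> f g; apply/fpsP => n; rewrite !(coefs_mulE _ _ (leqnn n)) mulrC.
Qed.

Lemma coefs_mul3 f g h n : coefs (fps_mul f (fps_mul g h)) n =
  (fps_trunc n f * (fps_trunc n g * fps_trunc n h))`_n.
Proof.
rewrite (coefs_mulE _ _ (leqnn n)) coefM [RHS]coefM; apply: eq_bigr => i _.
by rewrite [(fps_trunc n (_ _))`__]coef_trunc ?leq_subr // (coefs_mulE (m := n)) ?leq_subr.
Qed.

Lemma fps_mulA : associative fps_mul.
Proof.
move=> f g h; apply/fpsP => n; rewrite (fps_mulC (fps_mul f g)) !coefs_mul3.
by congr (_`__); rewrite mulrA mulrC.
Qed.

Lemma fps_mul1 : left_id fps_one fps_mul.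
Proof.
move=> f; apply/fpsP => n /=; rewrite big_ord_recl /= mul1r subn0 big1 ?addr0 //.
by move=> i _; rewrite mul0r.
Qed.

Lemma fps_mulDl : left_distributive fps_mul fps_add.
Proof.
move=> f g h; apply/fpsP => n /=; rewrite -big_split /=.
by apply: eq_bigr => i _; rewrite mulrDl.
Qed.

Lemma fps_one_neq0 : fps_one != 0.
Proof.
by apply/eqP => /fpsP /(_ 0%N) /= /eqP; rewrite oner_eq0.
Qed.

HB.instance Definition _ := GRing.Zmodule_isComNzRing.Build (fps K)
  fps_mulA fps_mulC fps_mul1 fps_mulDl fps_one_neq0.

Definition fps_unit : pred (fps K) := fun f => `[< exists g, g * f = 1 >].
Definition fps_inv f : fps K :=
  if pselect (exists g, g * f = 1) is left e then projT1 (cid e) else f.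

Lemma fps_mulVr : {in fps_unit, left_inverse 1 fps_inv *%R}.
Proof.
by move=> f /asboolP e; rewrite /fps_inv; case: pselect => // e'; case: cid.
Qed.
Lemma fps_unitP f g : g * f = 1 -> fps_unit f.
Proof. by move=> e; apply/asboolP; exists g. Qed.
Lemma fps_inv_out : {in [predC fps_unit], fps_inv =1 id}.
Proof.
by move=> f /asboolP e; rewrite /fps_inv; case: pselect.
Qed.

HB.instance Definition _ := GRing.ComNzRing_hasMulInverse.Build (fps K)
  fps_mulVr fps_unitP fps_inv_out.

Lemma fps_neq0_order f : f != 0 ->
  exists2 m, coefs f m != 0 & forall i, (i < m)%N -> coefs f i = 0.
Proof.
move=> f0; have [m fm]: exists m, coefs f m != 0.
  apply/not_existsP => f0'; move/eqP: f0; apply; apply/fpsP => n /=.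
  by apply/eqP/negPn/negP; apply: f0'.
have ex : exists m, coefs f m != 0 by exists m.
exists (ex_minn ex); case: ex_minnP => // k _ kmin i ik.
by apply/eqP/negPn/negP => /kmin; rewrite leqNgt ik.
Qed.

Lemma fps_idomain : GRing.integral_domain_axiom (fps K).
Proof.
move=> f g fg; apply/norP => -[/fps_neq0_order[m fm mmin]].
move=> /fps_neq0_order[n gn nmin].
move/fpsP: fg => /(_ (m + n)%N) /=.
have mlt : (m < (m + n).+1)%N by rewrite ltnS leq_addr.
rewrite (bigD1 (Ordinal mlt)) //= addKn big1 ?addr0; last first.
  move=> i im; have [/mmin->|mi] := ltnP i m; first by rewrite mul0r.
  have {}mi : (m < i)%N by rewrite ltn_neqAle eq_sym im mi.
  by rewrite nmin ?mulr0 // ltn_subLR ?ltn_add2r // -ltnS ltn_ord.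
by move=> /eqP; rewrite mulf_eq0 (negPf fm) (negPf gn).
Qed.

HB.instance Definition _ :=
  GRing.ComUnitRing_isIntegral.Build (fps K) fps_idomain.

Definition fps_of_poly (p : {poly K}) : fps K := Fps (fun n => p`_n).

Lemma fps_of_poly_is_zmod_morphism : zmod_morphism fps_of_poly.
Proof. by move=> p q; apply/fpsP => n /=; rewrite coefB. Qed.
Lemma fps_of_poly_is_monoid_morphism : monoid_morphism fps_of_poly.
Proof.
split=> [|p q]; apply/fpsP => n /=; first by rewrite coef1.
by rewrite coefM.
Qed.

HB.instance Definition _ := GRing.isZmodMorphism.Build
  {poly K} (fps K) fps_of_poly fps_of_poly_is_zmod_morphism.
HB.instance Definition _ := GRing.isMonoidMorphism.Build
  {poly K} (fps K) fps_of_poly fps_of_poly_is_monoid_morphism.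

Lemma fps_of_poly_inj : injective fps_of_poly.
Proof. by move=> p q /fpsP e; apply/polyP => n; apply: e. Qed.

End FpsRing.

Local Notation "x %:F" := (@FracField.tofrac _ x) : ring_scope.

Definition ratfun_to_laurent (K : fieldType)
    (x : {fraction {poly K}}) : {fraction fps K} :=
  (fps_of_poly \n_(repr x))%:F / (fps_of_poly \d_(repr x))%:F.

Section RatfunToLaurent.
Variable K : fieldType.
Local Notation "f ^s" := (fps_of_poly f)%:F (at level 2).

Lemma fps_of_poly_frac_eq0 (p : {poly K}) : (p^s == 0) = (p == 0).
Proof. by rewrite tofrac_eq0 -(inj_eq (@fps_of_poly_inj K)) rmorph0. Qed.

Lemma fraction_numden (x : {fraction {poly K}}) :
  x = (\n_(repr x))%:F / (\d_(repr x))%:F.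
Proof.
have d0 := denom_ratioP (repr x).
rewrite -[LHS]reprK; apply: (mulIf (x := (\d_(repr x))%:F)).
  by rewrite tofrac_eq0.
rewrite divfK ?tofrac_eq0 //.
set r := repr x; rewrite /FracField.tofrac.
unlock; rewrite !piE /=; apply/eqmodP => /=.
rewrite /FracField.equivf /FracField.mulf !numden_Ratio ?oner_neq0 ?mulr1 //.
by rewrite mulrC.
Qed.

Lemma ratfun_to_laurentE (p q : {poly K}) : q != 0 ->
  ratfun_to_laurent (p%:F / q%:F) = p^s / q^s.
Proof.
move=> q0; rewrite /ratfun_to_laurent.
set x := p%:F / q%:F; have d0 := denom_ratioP (repr x).
apply/eqP; rewrite eqr_div ?fps_of_poly_frac_eq0 //.
rewrite -!rmorphM /= !tofrac_eq (inj_eq (@fps_of_poly_inj K)) -tofrac_eq !rmorphM /=.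
by rewrite -eqr_div ?tofrac_eq0 // -fraction_numden.
Qed.

Lemma ratfun_to_laurent_is_zmod_morphism : zmod_morphism (@ratfun_to_laurent K).
Proof.
move=> x y; have dx := denom_ratioP (repr x); have dy := denom_ratioP (repr y).
rewrite {1}(fraction_numden x) {1}(fraction_numden y) -mulNr addf_div ?tofrac_eq0 //.
rewrite -!rmorphN -!rmorphM -!rmorphD /= ratfun_to_laurentE ?mulf_neq0 //.
rewrite /ratfun_to_laurent -mulNr addf_div ?fps_of_poly_frac_eq0 //.
by rewrite -!rmorphN -!rmorphM -!rmorphD.
Qed.

Lemma ratfun_to_laurent_is_monoid_morphism :
  monoid_morphism (@ratfun_to_laurent K).
Proof.
split=> [|x y].
  by rewrite -[1]divr1 -tofrac1 ratfun_to_laurentE ?oner_neq0 // !rmorph1 divr1.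
have dx := denom_ratioP (repr x); have dy := denom_ratioP (repr y).
rewrite {1}(fraction_numden x) {1}(fraction_numden y) mulf_div.
rewrite -!rmorphM /= ratfun_to_laurentE ?mulf_neq0 //.
by rewrite /ratfun_to_laurent mulf_div -!rmorphM.
Qed.

HB.instance Definition _ := GRing.isZmodMorphism.Build
  {fraction {poly K}} {fraction fps K} (@ratfun_to_laurent K)
  ratfun_to_laurent_is_zmod_morphism.
HB.instance Definition _ := GRing.isMonoidMorphism.Build
  {fraction {poly K}} {fraction fps K} (@ratfun_to_laurent K)
  ratfun_to_laurent_is_monoid_morphism.

End RatfunToLaurent.

Definition algebraic_fps (K : fieldType) (f : fps K) : Prop :=
  algebraicOver (@ratfun_to_laurent K) f%:F.

Definition ogf (K : fieldType) (a : nat -> nat) : fps K := Fps (fun n => (a n)%:R).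

(* Main.v *)
(* Counting paths by their rightmost allowed column gives
   sum_n LP_n t^n (1 - t)^(s_n) = 1.  From some index a on, s_(n+k) = s_n + l,
   so if t satisfies t^k (1 - t)^l = z^k, then for n >= a the weight
   t^n (1 - t)^(s_n) / z^n depends only on n modulo k.  There are k such power
   series t = z y, one for each value y(0) = c with c^k = 1, and the identity at
   these t is a linear system for the k subseries of the generating function
   over the classes modulo k.  Its coefficients are algebraic, and its
   determinant at z = 0 is, up to a nonzero factor, the Vandermonde determinant
   of the k-th roots of unity. *)

From HB Require Import structures.
Require Import Defs.
From mathcomp Require Import all_boot all_order all_algebra.
From mathcomp Require Import separable cyclotomic.
From mathcomp Require Import reals complex.
From mathcomp Require Import ring zify.

Set Implicit Arguments.
Unset Strict Implicit.
Unset Printing Implicit Defensive.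

Import GRing.Theory Num.Theory.
Local Open Scope nat_scope.

(** * Enumeration of paths by their last north step *)

Section BoundedPaths.
Variable s : nat -> nat.

(** The cutoff [x] on columns is independent of [s], which allows induction on it. After the last
    entry [y] is split off, the cutoff [y.+1] on the rest enforces monotonicity. *)
Fixpoint bounded_paths n x : seq (seq nat) :=
  if n is m.+1 then
    [seq rcons p y | y <- iota 0 (minn x (s m)), p <- bounded_paths m y.+1]
  else [:: [::]].

Lemma bounded_paths_uniq n x : uniq (bounded_paths n x).
Proof.
elim: n x => [|n IHn] x //=; apply: allpairs_uniq_dep => //=; first exact: iota_uniq.
by move=> [y p] [y' p'] _ _ /= /rcons_inj[-> ->].
Qed.

Lemma mem_bounded_paths n x p :
  (p \in bounded_paths n x) =
  [&& size p == n, sorted leq p, all (gtn x) p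
    & all (fun i => nth 0 p i < s i) (iota 0 n)].
Proof.
elim: n x p => [|n IHn] x p; first by rewrite inE; case: p.
have -> : iota 0 n.+1 = rcons (iota 0 n) n by rewrite -addn1 iotaD cats1.
have nthE q y : size q = n -> all (fun i => nth 0 (rcons q y) i < s i) (iota 0 n)
    = all (fun i => nth 0 q i < s i) (iota 0 n).
  by move=> szq; apply: eq_in_all => i; rewrite mem_iota nth_rcons szq => /= ->.
apply/allpairsPdep/idP => [[y] [q] [yx + ->]|].
  move: yx; rewrite mem_iota IHn add0n leq_min /=.
  move=> /andP[yx ys] /and4P[/eqP szq sq qy qs].
  rewrite size_rcons szq eqxx !all_rcons nthE // qs /= yx nth_rcons szq ltnn eqxx ys /=.
  rewrite (sub_all _ qy) ?andbT; last by move=> i /=; lia.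
  case: (q) sq qy => //= a r; rewrite rcons_path => -> /= /andP[ay /allP ry].
  by have := mem_last a r; rewrite inE => /predU1P[->|/ry].
case: (lastP p) => // q y /and4P[]; rewrite size_rcons eqSS => /eqP szq sqy.
rewrite !all_rcons nthE // nth_rcons szq ltnn eqxx => /andP[/= yx qx] /andP[ys qs].
exists y, q; rewrite mem_iota leq_min yx ys IHn szq eqxx qs; split=> //=.
move: sqy; rewrite -cats1 !sorted_pairwise ?pairwise_cat //=; try exact: leq_trans.
by rewrite allrel1r !andbT => /andP[qy ->]; apply: sub_all qy.
Qed.

Definition nb_paths n x := size (bounded_paths n x).

Lemma LPE n : LP s n = nb_paths n (s n).
Proof.
rewrite /LP /nb_paths cardE.
rewrite -(size_map (fun p : n.-tuple 'I_(s n) => map val p)).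
apply/perm_size/uniq_perm; rewrite ?bounded_paths_uniq //.
  rewrite map_inj_uniq ?enum_uniq // => p q /(inj_map val_inj) pq; exact: val_inj.
move=> q; rewrite mem_bounded_paths; apply/mapP/idP => [[p]|/and4P[szq sq qx qs]].
  rewrite mem_enum !inE => /andP[sp /forallP ps] ->.
  rewrite size_map size_tuple eqxx sp /=; apply/andP; split.
    by apply/allP => _ /mapP[i _ ->] /=; rewrite ltn_ord.
  apply/allP => i /[!mem_iota] /= /[!add0n] ltin.
  have := ps (Ordinal ltin); rewrite (tnth_nth (tnth p (Ordinal ltin))) /=.
  by rewrite (nth_map (tnth p (Ordinal ltin))) ?size_tuple.
have [r rq] : exists r : seq 'I_(s n), map val r = q.
  elim: q qx {szq sq qs} => [|y q IHq] /=; first by exists [::].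
  by move=> /andP[yx /IHq[r <-]]; exists (Ordinal yx :: r).
have szr : size r == n by rewrite -(size_map val) rq.
exists (Tuple szr); rewrite // mem_enum !inE rq sq /=; apply/forallP => i.
have /(allP qs) : (i : nat) \in iota 0 n by rewrite mem_iota ltn_ord.
have d := tnth (Tuple szr) i; by rewrite -rq (nth_map d) ?(eqP szr) // (tnth_nth d).
Qed.

Lemma nb_paths0 x : nb_paths 0 x = 1. Proof. by []. Qed.

Lemma nb_pathsS0 n : nb_paths n.+1 0 = 0.
Proof. by rewrite /nb_paths /= min0n. Qed.

(** The extra paths have their last north step in column [x], which requires [x < s n]. Removing
    that step leaves a path that may still use column [x], hence the cutoff [x.+1] in the last
    factor. *)
Lemma nb_pathsS n x :
  nb_paths n.+1 x.+1 = nb_paths n.+1 x + (x < s n) * nb_paths n x.+1.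
Proof.
have E y : nb_paths n.+1 y =
    size [seq rcons p z | z <- iota 0 (minn y (s n)), p <- bounded_paths n z.+1].
  by [].
rewrite !E {E}.
have [xs|sx] := ltnP x (s n); last first.
  by rewrite mul0n addn0 (minn_idPr (leqW sx)).
rewrite (minn_idPl xs) -[in LHS]addn1 iotaD.
rewrite /allpairs map_cat flatten_cat size_cat /= add0n cats0 size_map.
by rewrite mul1n.
Qed.

Lemma nb_paths_stable n x :
  {homo s : i j / i <= j} -> s n <= x -> nb_paths n x = LP s n.
Proof.
move=> s_homo; rewrite LPE /nb_paths; case: n => //= n sx.
have sn : s n <= s n.+1 by exact: s_homo.
by rewrite (minn_idPr (leq_trans sn sx)) (minn_idPr sn).
Qed.

End BoundedPaths.

(** * The counting identity modulo powers of [t] *)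

Local Open Scope ring_scope.

(** Stating the identity as a congruence modulo [t ^+ N] avoids infinite sums in [A]. For [t] a
    multiple of [z], the error is divisible by [z ^+ N]. *)
Lemma LP_identity (A : comNzRingType) (t : A) (s : nat -> nat) N :
  right_boundary s ->
  exists r, 1 - \sum_(n < N) (LP s n)%:R * t ^+ n * (1 - t) ^+ s n = t ^+ N * r.
Proof.
move=> [s_gt0 s_homo]; set w := 1 - t.
(* The first N terms of the identity for paths confined to columns < x; by the
   recurrence [nb_pathsS] it changes by a multiple of t ^+ N as x grows. *)
pose D x : A := \sum_(n < N) t ^+ n *
  ((nb_paths s n x)%:R * w ^+ x + (LP s n)%:R * (w ^+ minn (s n) x - w ^+ x)).
suff D1 x : exists r, 1 - D x = t ^+ N * r.
  have [r Dr] := D1 (s N); exists r; rewrite -{}Dr; congr (1 - _).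
  apply: eq_bigr => n _; have sN : (s n <= s N)%N by apply/s_homo/ltnW.
  by rewrite nb_paths_stable // (minn_idPl sN); ring.
elim: x => [|x [r IHx]].
  (* For [N = 0] the modulus is 1. Otherwise only the empty path fits into zero columns, so [D 0] is
     exactly 1. *)
  case: N @D => [|N] D; first by exists (1 - D 0%N); rewrite mul1r.
  exists 0; rewrite mulr0 /D big_ord_recl big1 => [|i _] /=.
    by rewrite nb_paths0 minn0; ring.
  by rewrite nb_pathsS0 minn0; ring.
(* The difference counts paths whose last north step is in column [x]. The [n]-th term of [D]
   changes by [w ^+ x * (g n - g n.+1)], so the total change telescopes. *)
pose g n : A := t ^+ n * ((nb_paths s n x.+1)%:R - (nb_paths s n x)%:R).
suff DS : D x.+1 = D x - w ^+ x * g N.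
  exists (r + w ^+ x * ((nb_paths s N x.+1)%:R - (nb_paths s N x)%:R)).
  by rewrite DS opprB addrCA addrC mulrDr -IHx /g; ring.
have gE n : t ^+ n * t * ((x < s n)%N%:R * (nb_paths s n x.+1)%:R) = g n.+1.
  by rewrite /g nb_pathsS natrD natrM exprSr; ring.
have g0 : g 0%N = 0 by rewrite /g !nb_paths0 subrr mulr0.
rewrite -[g N]subr0 -g0 -(telescope_sumr g (leq0n N)) big_mkord mulr_sumr.
rewrite /D -sumrB; apply: eq_bigr => n _; rewrite -gE /g.
case: ltnP => [xs|sx].
  by rewrite (minn_idPr xs) exprS /w /=; ring.
rewrite (minn_idPl (leqW sx)) !nb_paths_stable //; last exact: leqW.
rewrite exprS /w /=; ring.
Qed.

(** Normalized derivatives avoid division by factorials, so any commutative ring will do. *)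
Lemma horner_taylor2 (A : comNzRingType) (P : {poly A}) (x h : A) :
  exists q, P.[x + h] = P.[x] + P^`().[x] * h + h ^+ 2 * q.
Proof.
have sz : (size P <= (size P).+2)%N by rewrite -addn2 leq_addr.
rewrite (nderiv_taylor_wide (mulrC x h) sz) !big_ord_recl /=.
rewrite nderivn0 nderivn1 expr0 expr1 mulr1 addrA.
exists (\sum_(i < size P) P^`N(i.+2).[x] * h ^+ i); congr (_ + _).
rewrite mulr_sumr; apply: eq_bigr => i _.
by rewrite /= /bump /= !add1n [RHS]mulrCA -exprD.
Qed.

(* A root Y over K[[z]], for a = z, gives t = z Y with t^k (1 - t)^l = z^k. *)
Definition kernel_poly (A : comNzRingType) k l (a : A) : {poly A} :=
  'X^k * (1 - a *: 'X) ^+ l - 1.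

Lemma horner_kernel_poly (A : comNzRingType) k l (a y : A) :
  (kernel_poly k l a).[y] = y ^+ k * (1 - a * y) ^+ l - 1.
Proof. by rewrite !hornerE. Qed.

Lemma kernel_poly_neq0 (A : comNzRingType) k l (a : A) :
  (0 < k)%N -> kernel_poly k l a != 0.
Proof.
move=> k0; apply/eqP => /(congr1 (horner^~ 0)) /eqP.
by rewrite /= horner_kernel_poly horner0 expr0n gtn_eqF // mul0r sub0r oppr_eq0 oner_eq0.
Qed.

Lemma map_kernel_poly (A B : comNzRingType) (f : {rmorphism A -> B}) k l (a : A) :
  map_poly f (kernel_poly k l a) = kernel_poly k l (f a).
Proof.
rewrite rmorphB rmorphM rmorphXn rmorph1 /= rmorphXn rmorphB rmorph1 /=.
by rewrite map_polyZ map_polyX.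
Qed.

(** * Power series: truncation, Hensel lifting, algebraicity *)

Section PowerSeries.
Variable K : fieldType.
Implicit Types (f g h y : fps K) (P : {poly fps K}).

Local Notation z := (fps_of_poly 'X : fps K).
Definition fps_const (c : K) : fps K := fps_of_poly c%:P.

Lemma coefs_sum I (r : seq I) (Q : pred I) (F : I -> fps K) n :
  coefs (\sum_(i <- r | Q i) F i) n = \sum_(i <- r | Q i) coefs (F i) n.
Proof. exact: (big_morph (fun f => coefs f n)). Qed.

Lemma coefs_XnM N f n :
  coefs (z ^+ N * f) n = if (n < N)%N then 0 else coefs f (n - N).
Proof.
rewrite -rmorphXn /=; under eq_bigr do rewrite coefXn.
case: ltnP => [nN|Nn].
  rewrite big1 // => i _; rewrite (_ : _ == N = false) ?mul0r //.
  by apply/eqP => iN; move: (ltn_ord i); rewrite iN; lia.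
have Nn1 : (N < n.+1)%N by [].
rewrite (bigD1 (Ordinal Nn1)) //= eqxx mul1r big1 ?addr0 // => i iN.
by rewrite (_ : _ == N = false) ?mul0r //; apply/negbTE.
Qed.

Definition const_coef f : K := coefs f 0.
Arguments const_coef : simpl never.

Lemma const_coef_is_zmod_morphism : zmod_morphism const_coef.
Proof. by []. Qed.
Lemma const_coef_is_monoid_morphism : monoid_morphism const_coef.
Proof. by split=> // f g; rewrite /const_coef /= big_ord1. Qed.

HB.instance Definition _ := GRing.isZmodMorphism.Build
  (fps K) K const_coef const_coef_is_zmod_morphism.
HB.instance Definition _ := GRing.isMonoidMorphism.Build
  (fps K) K const_coef const_coef_is_monoid_morphism.

Lemma const_coef_X : const_coef z = 0.
Proof. by rewrite /const_coef /= coefX. Qed.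

Lemma const_coef_const c : const_coef (fps_const c) = c.
Proof. by rewrite /const_coef /= coefC. Qed.

Lemma fps_truncE N f :
  exists q, f = \sum_(n < N) fps_const (coefs f n) * z ^+ n + z ^+ N * q.
Proof.
exists (Fps (fun n => coefs f (n + N)%N)).
under eq_bigr do rewrite -rmorphXn -rmorphM /= mul_polyC.
rewrite -rmorph_sum -poly_def; apply/fpsP => n.
transitivity ((\poly_(i < N) coefs f i)`_n
    + coefs (z ^+ N * Fps (fun n => coefs f (n + N)%N)) n); last by [].
rewrite coefs_XnM coef_poly; case: ltnP => [|Nn]; first by rewrite addr0.
by rewrite add0r /= subnK.
Qed.

Lemma fps_dvdXn N f :
  (forall i, (i < N)%N -> coefs f i = 0) -> exists q, f = z ^+ N * q.
Proof.
move=> f0; have [q fE] := fps_truncE N f; exists q.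
by rewrite [LHS]fE big1 ?add0r // => i _; rewrite f0 // /fps_const !rmorph0 mul0r.
Qed.

(** This replaces convergence: equalities of series are checked modulo every power of [z]. *)
Lemma fps_eq0 f : (forall N, exists q, f = z ^+ N * q) -> f = 0.
Proof.
move=> fN; apply/fpsP => n; have [q ->] := fN n.+1.
by rewrite coefs_XnM ltnSn.
Qed.

Lemma fps_hensel P y0 : const_coef P.[y0] = 0 -> const_coef P^`().[y0] != 0 ->
  exists2 y, P.[y] = 0 & const_coef y = const_coef y0.
Proof.
move=> Py0 dPy0; pose u := (const_coef P^`().[y0])^-1.
(* The linear correction cancels coefficient n + 1 of P.[y]; the slope at y0
   serves at every step, since only its constant term matters. *)
pose newton n y := y - z ^+ n.+1 * fps_const (u * coefs P.[y] n.+1).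
pose Y := fix Y n := if n is m.+1 then newton m (Y m) else y0.
have YS n : Y n.+1 = newton n (Y n) by [].
(* Stage [n] corrects only degrees above [n], so coefficient [i] is final from stage [i] on. The
   limit is therefore the diagonal series with coefficients [coefs (Y n) n]. *)
have coefsY i d : coefs (Y (d + i)%N) i = coefs (Y i) i.
  elim: d => // d IHd; rewrite addSn YS -{}IHd /newton.
  rewrite -[LHS]/(coefs (Y (d + i)%N) i - coefs (z ^+ (d + i).+1 * _) i).
  by rewrite coefs_XnM ltnS leq_addl subr0.
have Y0 n : const_coef (Y n) = const_coef y0.
  by rewrite -[LHS]/(coefs (Y n) 0%N) -{1}[n]addn0 coefsY.
have PY n i : (i <= n)%N -> coefs P.[Y n] i = 0.
  elim: n i => [|n IHn] i; first by case: i.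
  move=> i_le; rewrite YS /newton; set c := fps_const _.
  have [q ->] := horner_taylor2 P (Y n) (- (z ^+ n.+1 * c)).
  have -> : P.[Y n] + P^`().[Y n] * - (z ^+ n.+1 * c) + (- (z ^+ n.+1 * c)) ^+ 2 * q
      = P.[Y n] + z ^+ n.+1 * (z ^+ n.+1 * (c ^+ 2 * q) - P^`().[Y n] * c).
    rewrite -addrA mulrBr sqrrN [_ - _]addrC mulrN mulrCA.
    by rewrite exprMn !mulrA -expr2.
  set g := _ - _ * c.
  rewrite -[LHS]/(coefs P.[Y n] i + coefs (z ^+ n.+1 * g) i) coefs_XnM.
  case: ltnP => [i_lt|i_ge]; first by rewrite IHn // addr0.
  have {i_le i_ge} -> : i = n.+1 by apply/eqP; rewrite eqn_leq i_le.
  rewrite subnn -/(const_coef g) /g rmorphB !rmorphM rmorphXn /=.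
  rewrite const_coef_X /c const_coef_const expr0n /= mul0r sub0r.
  rewrite -horner_map /= Y0 horner_map /u mulVKf //; exact: subrr.
exists (Fps (fun n => coefs (Y n) n)); last exact: Y0 0%N.
set y := Fps _; apply: fps_eq0 => N.
have [h yE] : exists h, y - Y N = z ^+ N * h.
  apply: fps_dvdXn => i iN.
  rewrite -[LHS]/(coefs (Y i) i - coefs (Y N) i).
  by rewrite -{1}(subnK (ltnW iN)) coefsY subrr.
have [g PYE] : exists g, P.[Y N] = z ^+ N * g.
  by apply: fps_dvdXn => i iN; apply/PY/ltnW.
have [q] := horner_taylor2 P (Y N) (y - Y N).
rewrite addrC subrK PYE yE => ->.
exists (g + P^`().[Y N] * h + h * (z ^+ N * h) * q).
rewrite 2!mulrDr expr2 -!mulrA; congr (_ + _ + _); exact: mulrCA.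
Qed.

(** At [z = 0] the kernel polynomial becomes ['X^k - 1], of which [c] is a simple root because [k]
    is nonzero in [K]. Hensel lifting applies. *)
Lemma kernel_root k l c : c ^+ k = 1 -> k%:R != 0 :> K ->
  exists2 y, y ^+ k * (1 - z * y) ^+ l = 1 & const_coef y = c.
Proof.
move=> ck k0; pose P := kernel_poly k l z.
have PE := horner_kernel_poly k l z : forall y, P.[y] = _.
have Pc : map_poly const_coef P = 'X^k - 1.
  rewrite map_kernel_poly /= const_coef_X /kernel_poly scale0r subr0 expr1n.
  by rewrite mulr1.
have [||y Py yc] := @fps_hensel P (fps_const c).
- rewrite PE rmorphB rmorphM !rmorphXn rmorphB rmorphM /= const_coef_X.
  by rewrite const_coef_const mul0r rmorph1 subr0 expr1n mulr1 ck subrr.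
- rewrite -horner_map /= -deriv_map Pc const_coef_const !derivE !hornerE.
  rewrite subr0 hornerMn hornerXn -mulr_natl mulf_neq0 // expf_neq0 //.
  apply: contra_eq_neq ck => ->.
  by rewrite expr0n; case: (k) k0 => [|m _]; rewrite ?eqxx //= eq_sym oner_eq0.
exists y; last by rewrite yc const_coef_const.
by apply/eqP; rewrite -subr_eq0 -PE Py.
Qed.

Lemma ratfun_to_laurent_tofrac (p : {poly K}) :
  ratfun_to_laurent (FracField.tofrac p) = FracField.tofrac (fps_of_poly p).
Proof.
rewrite -[FracField.tofrac p]divr1 -[1]tofrac1 ratfun_to_laurentE ?oner_neq0 //.
by rewrite !rmorph1 divr1.
Qed.

Lemma algebraic_fps_poly (p : {poly K}) : algebraic_fps (fps_of_poly p).
Proof.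
by rewrite /algebraic_fps -ratfun_to_laurent_tofrac; apply: algebraic_id.
Qed.

Lemma algebraic_fpsN f : algebraic_fps f -> algebraic_fps (- f).
Proof. by rewrite /algebraic_fps rmorphN; apply: algebraic_opp. Qed.

Lemma algebraic_fpsD f g :
  algebraic_fps f -> algebraic_fps g -> algebraic_fps (f + g).
Proof. by rewrite /algebraic_fps rmorphD; apply: algebraic_add. Qed.

Lemma algebraic_fpsM f g :
  algebraic_fps f -> algebraic_fps g -> algebraic_fps (f * g).
Proof. by rewrite /algebraic_fps rmorphM; apply: algebraic_mul. Qed.

Lemma algebraic_fps0 : algebraic_fps (0 : fps K).
Proof. by rewrite -(rmorph0 (@fps_of_poly K)); apply: algebraic_fps_poly. Qed.

Lemma algebraic_fps1 : algebraic_fps (1 : fps K).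
Proof. by rewrite -(rmorph1 (@fps_of_poly K)); apply: algebraic_fps_poly. Qed.

Lemma algebraic_fpsX f n : algebraic_fps f -> algebraic_fps (f ^+ n).
Proof.
move=> fA; elim: n => [|n IHn]; first exact: algebraic_fps1.
by rewrite exprS; apply: algebraic_fpsM.
Qed.

Lemma algebraic_fps_sum I (r : seq I) (Q : pred I) (F : I -> fps K) :
  (forall i, algebraic_fps (F i)) -> algebraic_fps (\sum_(i <- r | Q i) F i).
Proof.
move=> FA; apply: big_ind => [|f g|i _]; last exact: FA.
  exact: algebraic_fps0.
exact: algebraic_fpsD.
Qed.

Lemma algebraic_fps_det n (M : 'M[fps K]_n) :
  (forall i j, algebraic_fps (M i j)) -> algebraic_fps (\det M).
Proof.
move=> MA; apply: algebraic_fps_sum => s; apply: algebraic_fpsM.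
  exact/algebraic_fpsX/algebraic_fpsN/algebraic_fps1.
apply: big_ind => [|f g|i _]; last exact: MA.
  exact: algebraic_fps1.
exact: algebraic_fpsM.
Qed.

(** Cramer's rule: the adjugate expresses [\det M * x] through [M *m x]. The division by [\det M]
    takes place in the fraction field, so a nonzero determinant suffices. *)
Lemma algebraic_fps_solve n (M : 'M[fps K]_n) (x : 'cV_n) :
  \det M != 0 -> (forall i j, algebraic_fps (M i j)) ->
  (forall i, algebraic_fps ((M *m x) i 0)) -> forall i, algebraic_fps (x i 0).
Proof.
move=> M0 MA bA i.
have adjA j j' : algebraic_fps ((\adj M) j j').
  rewrite mxE; apply: algebraic_fpsM.
    exact/algebraic_fpsX/algebraic_fpsN/algebraic_fps1.
  by apply: algebraic_fps_det => i1 i2; rewrite !mxE.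
have dxA : algebraic_fps (\det M * x i 0).
  have -> : \det M * x i 0 = (\adj M *m (M *m x)) i 0.
    by rewrite mulmxA mul_adj_mx mul_scalar_mx mxE.
  by rewrite mxE; apply: algebraic_fps_sum => j; apply: algebraic_fpsM.
rewrite /algebraic_fps.
have -> : FracField.tofrac (x i 0) =
    FracField.tofrac (\det M * x i 0) / FracField.tofrac (\det M).
  by rewrite rmorphM mulrAC mulfV ?mul1r // tofrac_eq0.
exact: algebraic_div dxA (algebraic_fps_det MA).
Qed.

Lemma kernel_root_algebraic k l y : (0 < k)%N ->
  y ^+ k * (1 - z * y) ^+ l = 1 -> algebraic_fps y.
Proof.
move=> k0 yE; pose Z : {fraction {poly K}} := FracField.tofrac 'X.
exists (kernel_poly k l Z); first exact: kernel_poly_neq0.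
rewrite map_kernel_poly /root horner_kernel_poly /= ratfun_to_laurent_tofrac.
by rewrite -rmorphM -(rmorph1 (@FracField.tofrac _)) -rmorphB -!rmorphXn
  -rmorphM yE subrr.
Qed.

End PowerSeries.

Arguments const_coef {K} f : simpl never.

(** As [k] is nonzero in [F], ['X^k - 1] is separable and its [k] roots are distinct. *)
Lemma roots_of_unity (F : closedFieldType) k : k%:R != 0 :> F ->
  exists2 c : 'I_k -> F, injective c & forall j, c j ^+ k = 1.
Proof.
move=> k0; have k_gt0 : (0 < k)%N by case: (k) k0; rewrite ?eqxx.
have [r rE] := closed_field_poly_normal ('X^k - 1 : {poly F}).
move: rE; rewrite (monicP _) ?monicXnsubC // scale1r => rE.
have szr : size r = k.
  by apply/eq_add_S; rewrite -(size_prod_XsubC _ id) -rE size_XnsubC.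
have r_uniq : uniq r by rewrite -separable_prod_XsubC -rE separable_Xn_sub_1.
exists (fun j => r`_j) => [i j /eqP|j].
  by rewrite nth_uniq ?szr ?ltn_ord // => /eqP/val_inj.
have : root (\prod_(z <- r) ('X - z%:P)) r`_j.
  by rewrite root_prod_XsubC mem_nth // szr.
by rewrite -rE rootE !hornerE subr_eq0 => /eqP.
Qed.

(** * The linear system for the residue classes *)

Section PeriodicIncrements.
Variables (s : nat -> nat) (a k l : nat).
Hypotheses (s_boundary : right_boundary s) (k_gt0 : (0 < k)%N).
Hypothesis s_period : forall n, (a <= n)%N -> s (n + k)%N = (s n + l)%N.

(** Indices below [a] form singleton classes; the others are grouped modulo [k], with
    representatives from [a] to [a + k - 1]. *)
Definition residue n := if (n < a)%N then n else (a + (n - a) %% k)%N.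

Lemma residue_lt n : (residue n < a + k)%N.
Proof.
rewrite /residue; case: (ltnP n a) => [na|_]; first exact: ltn_addr.
by rewrite ltn_add2l ltn_pmod.
Qed.

Lemma residueP n : exists q,
  n = (residue n + q * k)%N /\ s n = (s (residue n) + q * l)%N.
Proof.
rewrite /residue; case: ltnP => an; first by exists 0%N; rewrite !mul0n !addn0.
exists ((n - a) %/ k)%N; set r := (a + _)%N.
have nE : n = (r + (n - a) %/ k * k)%N.
  by rewrite /r -addnA [(_ %% _ + _)%N]addnC -divn_eq subnKC.
split=> //; rewrite {1}nE; elim: (_ %/ _)%N => [|q IHq]; first by rewrite !addn0.
by rewrite !mulSn [(k + _)%N]addnC addnA s_period ?IHq /r; lia.
Qed.

Variable K : fieldType.
Local Notation z := (fps_of_poly 'X : fps K).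

(* The n-th term of the identity at t = z y is LP_n z^n times this. *)
Definition weight (y : fps K) n := y ^+ n * (1 - z * y) ^+ s n.

Definition residue_series m : fps K :=
  Fps (fun n => if residue n == m then (LP s n)%:R else 0).

Lemma weight_residue y n : y ^+ k * (1 - z * y) ^+ l = 1 ->
  weight y n = weight y (residue n).
Proof.
move=> yE; have [q [nE sE]] := residueP n.
rewrite /weight {1}nE sE !exprD mulrACA ![(q * _)%N]mulnC !exprM.
by rewrite -exprMn yE expr1n mulr1.
Qed.

Lemma ogf_residue : ogf K (LP s) = \sum_(m < a + k) residue_series m.
Proof.
apply/fpsP => n; rewrite coefs_sum (bigD1 (Ordinal (residue_lt n))) //= eqxx.
rewrite big1 ?addr0 // => m mn; rewrite ifN //; apply: contraNneq mn => rn.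
exact/eqP/val_inj.
Qed.

Lemma residue_series_lt m :
  (m < a)%N -> residue_series m = fps_of_poly ((LP s m)%:R *: 'X^m).
Proof.
move=> ma; apply/fpsP => n /=; rewrite coefZ coefXn.
suff -> : (residue n == m) = (n == m).
  by case: eqP => [->|_]; rewrite ?mulr1 ?mulr0.
rewrite /residue; case: ltnP => // an; lia.
Qed.

(** This is [LP_identity] at [t = z * y], grouped by residue. Since the weight is constant on each
    class, it becomes a finite linear equation. *)
Lemma sum_weight_residue y : y ^+ k * (1 - z * y) ^+ l = 1 ->
  \sum_(m < a + k) weight y m * residue_series m = 1.
Proof.
move=> yE; apply/eqP; rewrite eq_sym -subr_eq0; apply/eqP/fps_eq0 => N.
have [r rE] := LP_identity (z * y) N s_boundary.
have [q qE] := fin_all_exists (fun m : 'I_(a + k) => fps_truncE N (residue_series m)).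
exists (y ^+ N * r - \sum_(m < a + k) weight y m * q m).
rewrite mulrBr mulrA -exprMn -rE -addrA -opprD; congr (1 - _).
transitivity (\sum_(m < a + k) (\sum_(n < N)
    weight y m * (fps_const (coefs (residue_series m) n) * z ^+ n)
    + z ^+ N * (weight y m * q m))).
  by apply: eq_bigr => m _; rewrite [in LHS]qE mulrDr mulr_sumr mulrCA.
rewrite big_split /= -mulr_sumr; congr (_ + _).
rewrite exchange_big; apply: eq_bigr => n _.
(* Only the class of [n] has a nonzero coefficient in degree [n]. *)
rewrite (bigD1 (Ordinal (residue_lt n))) //= eqxx big1 ?addr0 => [|m mn].
  rewrite -weight_residue // /weight /fps_const !rmorph_nat exprMn.
  by rewrite [LHS]mulrC !mulrA.
rewrite ifN ?/fps_const ?rmorph0 ?mul0r ?mulr0 //.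
by apply: contraNneq mn => rn; apply/eqP/val_inj.
Qed.

Lemma weight_algebraic y n : y ^+ k * (1 - z * y) ^+ l = 1 ->
  algebraic_fps (weight y n).
Proof.
move=> yE; have yA := kernel_root_algebraic k_gt0 yE.
apply: algebraic_fpsM; apply: algebraic_fpsX; first exact: yA.
apply: algebraic_fpsD; first exact: algebraic_fps1.
apply: algebraic_fpsN; apply: algebraic_fpsM; last exact: yA.
exact: algebraic_fps_poly.
Qed.

Lemma const_coef_weight y n : const_coef (weight y n) = const_coef y ^+ n.
Proof.
rewrite /weight rmorphM !rmorphXn rmorphB rmorphM rmorph1 /= const_coef_X.
by rewrite mul0r subr0 expr1n mulr1.
Qed.

Lemma algebraic_ogf_LP (c : 'I_k -> K) : k%:R != 0 :> K ->
  injective c -> (forall j, c j ^+ k = 1) -> algebraic_fps (ogf K (LP s)).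
Proof.
move=> k0 c_inj ck.
have [y yE yc] := fin_all_exists2 (fun j => kernel_root l (ck j) k0).
have seriesA (m : 'I_a) : algebraic_fps (residue_series m).
  by rewrite residue_series_lt //; apply: algebraic_fps_poly.
(* Only the [k] classes from [a] on are unknowns; the series of index below [a] are monomials and
   move to the right-hand side. *)
pose M : 'M[fps K]_k := \matrix_(j, r) weight (y j) (a + r)%N.
pose x : 'cV[fps K]_k := \col_r residue_series (a + r)%N.
have xA : forall r, algebraic_fps (x r 0).
  apply: (@algebraic_fps_solve K k M x) => [|i j|j].
  - suff : const_coef (\det M) != 0 by apply: contraNneq => ->; rewrite rmorph0.
    (* At [z = 0] row [j] is [c j ^+ a] times the powers of [c j]. The [c j] are nonzero and
       distinct, so the determinant does not vanish. *)
    have ME : map_mx const_coef M =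
        diag_mx (\row_j c j ^+ a) *m (Vandermonde k (\row_j c j))^T.
      apply/matrixP => j r; rewrite mul_diag_mx !mxE const_coef_weight yc.
      by rewrite exprD.
    rewrite -det_map_mx ME det_mulmx det_diag det_tr det_Vandermonde.
    rewrite mulf_neq0 //; apply/prodf_neq0.
      move=> j _; rewrite mxE expf_neq0 //; apply: contra_eq_neq (ck j) => ->.
      by rewrite expr0n gtn_eqF // eq_sym oner_eq0.
    move=> i _; apply/prodf_neq0 => j ij; rewrite !mxE subr_eq0.
    by apply: contraTneq ij => /c_inj ->; rewrite ltnn.
  - by rewrite mxE; apply: weight_algebraic.
  - have -> : (M *m x) j 0 = 1 - \sum_(m < a) weight (y j) m * residue_series m.
      rewrite mxE -(sum_weight_residue (yE j)) big_split_ord /= addrAC subrr add0r.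
      by apply: eq_bigr => r _; rewrite !mxE.
    apply: algebraic_fpsD; first exact: algebraic_fps1.
    apply: algebraic_fpsN; apply: algebraic_fps_sum => m.
    by apply: algebraic_fpsM; [apply: weight_algebraic|apply: seriesA].
rewrite ogf_residue big_split_ord /=.
apply: algebraic_fpsD; apply: algebraic_fps_sum => r; first exact: seriesA.
by have := xA r; rewrite mxE.
Qed.

End PeriodicIncrements.

(** Past the prefix, adding [k] to the index keeps the remainder and raises the quotient by one; the
    shift by the last prefix term is the same on both sides. *)
Lemma ultimately_periodic_increments s : ultimately_periodic s ->
  exists a k l, (0 < k)%N /\ forall n, (a <= n)%N -> s (n + k)%N = (s n + l)%N.
Proof.
move=> [s' [s'' [k [l [[k0 [t [_ _ _ tE]]] sE]]]]].
exists (size s'), k, l; split=> // n an.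
rewrite !sE ltnNge (leq_trans an (leq_addr _ _)) ltnNge an /=.
by rewrite -addnBAC // !tE modnDr divnDr // divnn k0; lia.
Qed.

Theorem theorem1p1 (R : realType) (s : nat -> nat)
  (s_boundary : right_boundary s) (s_up : ultimately_periodic s) :
  algebraic_fps (ogf R[i]%C (LP s)).
Proof.
have [a [k [l [k0 s_period]]]] := ultimately_periodic_increments s_up.
have kR : k%:R != 0 :> R[i]%C by rewrite pnatr_eq0 -lt0n.
have [c c_inj ck] := roots_of_unity kR.
exact: (algebraic_ogf_LP s_boundary k0 s_period kR c_inj ck).
Qed.
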